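(* Let $\mu$ be a Gibbs distribution on $[q]^V$ (for a graph $G=(V,E)$) satisfying $C$-coupling independence, and let $R>0$ be an integer. For any $\Lambda\subseteq V$ and any two partial configurations $\sigma,\tau\in[q]^\Lambda$ that disagree only at some vertex $v\in\Lambda$, there is a coupling $\mathcal C$ of $\mu^\sigma$ and $\mu^\tau$ such that $$\mathbb E_{(\sigma',\tau')\sim\mathcal C}\Big[\sum_{u\in S_R(v)}\mathbf 1[\sigma'(u)\ne\tau'(u)]\Big]\le 2C\left(\tfrac12\right)^{\lceil R/(2C)\rceil}.$$ As a consequence, $\mu$ satisfies total influence decay with rate $\delta(x)=2C\cdot 2^{-\lceil x/(2C)\rceil}$, i.e. for all such $\sigma,\tau,v$ and every integer $\ell>0$, $\sum_{u\in S_\ell(v)}d_{TV}(\mu^\sigma_u,\mu^\tau_u)\le 2C\cdot2^{-\lceil \ell/(2C)\rceil}$.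
   Context: The Gibbs distribution $\mu$ comes from a spin system on $G=(V,E)$: $\mu(\sigma)\propto\prod_{\{u,v\}\in E}A_E(\sigma(u),\sigma(v))\prod_{v}A_V(\sigma(v))$ with $A_E\in\mathbb{R}_{\ge0}^{q\times q}$, $A_V\in\mathbb{R}_{\ge0}^q$. For $\Lambda\subseteq V$ and a (possibly infeasible) $\sigma\in[q]^\Lambda$, $\mu^\sigma(\tau)\propto\mathbf 1[\tau|_\Lambda=\sigma]\prod_{v\notin\Lambda}A_V(\tau(v))\prod_{\{u,v\}\in E,u\notin\Lambda,v\in\Lambda}A_E(\tau(u),\sigma(v))\prod_{\{u,v\}\in E,u,v\notin\Lambda}A_E(\tau(u),\tau(v))$ for $\tau\in[q]^V$ (assumed well defined, i.e. the normaliser is positive), and $\mu^\sigma_u$ is its marginal at $u$. $C$-coupling independence: for every $\Lambda\subseteq V$ and $\sigma,\tau\in[q]^\Lambda$ differing in exactly one vertex, there is a coupling $(X,Y)$ of $\mu^\sigma,\mu^\tau$ with expected Hamming distance (number of vertices where $X,Y$ differ) at most $C$. $S_\ell(v)=\{u\in V:\mathrm{dist}_G(u,v)=\ell\}$ is the sphere of radius $\ell$ around $v$ in graph distance; $d_{TV}$ is total variation distance. *)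

(* Defs.v *)
From HB Require Import structures.
From mathcomp Require Import all_boot all_order all_algebra.
From mathcomp Require Import reals.
Set Implicit Arguments. Unset Strict Implicit. Unset Printing Implicit Defensive.
Import Order.TTheory GRing.Theory Num.Theory.
Local Open Scope ring_scope.

Section Gibbs.
Variables (R : realType) (V : finType) (q : nat).
(* the graph G = (V,E): a symmetric irreflexive relation e on V *)
Variable e : rel V.
Variables (AE : 'I_q -> 'I_q -> R) (AV : 'I_q -> R).

Definition config := {ffun V -> 'I_q}.

(* each undirected edge {u,v} is counted once, oriented by enum_rank *)
Definition edge_or (u v : V) : bool := e u v && (enum_rank u < enum_rank v)%N.

(* A partial configuration sigma in [q]^Lambda is represented by a function
   V -> 'I_q whose values outside Lambda are irrelevant. *)
Definition pin_weight (L : {set V}) (sigma : V -> 'I_q) (tau : config) : R :=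
  (if [forall v in L, tau v == sigma v] then 1 else 0) *
  (\prod_(v | v \notin L) AV (tau v)) *
  (\prod_(u : V) \prod_(w : V | edge_or u w && ~~ ((u \in L) && (w \in L)))
      AE (tau u) (tau w)).

Definition pin_Z (L : {set V}) (sigma : V -> 'I_q) : R :=
  \sum_(tau : config) pin_weight L sigma tau.

Definition well_defined (L : {set V}) (sigma : V -> 'I_q) : Prop :=
  0 < pin_Z L sigma.

Definition mu_pin (L : {set V}) (sigma : V -> 'I_q) (tau : config) : R :=
  pin_weight L sigma tau / pin_Z L sigma.

Definition mu_marg (L : {set V}) (sigma : V -> 'I_q) (u : V) (c : 'I_q) : R :=
  \sum_(tau : config | tau u == c) mu_pin L sigma tau.

Definition dTV_marg (L : {set V}) (sigma tau : V -> 'I_q) (u : V) : R :=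
  2^-1 * \sum_(c : 'I_q) `|mu_marg L sigma u c - mu_marg L tau u c|.

Definition is_coupling (p1 p2 : config -> R) (pi : config * config -> R) : Prop :=
  (forall xy, 0 <= pi xy) /\
  (forall x, \sum_(y : config) pi (x, y) = p1 x) /\
  (forall y, \sum_(x : config) pi (x, y) = p2 y).

Definition exp_disagree (pi : config * config -> R) (P : pred V) : R :=
  \sum_(xy : config * config)
     pi xy * (#|[set u | P u & xy.1 u != xy.2 u]|)%:R.

Definition differ_only_at (L : {set V}) (sigma tau : V -> 'I_q) (v : V) : Prop :=
  v \in L /\ sigma v != tau v /\ (forall w, w \in L -> w != v -> sigma w = tau w).

Definition coupling_independence (C : R) : Prop :=
  forall (L : {set V}) (sigma tau : V -> 'I_q) (v : V),
    differ_only_at L sigma tau v ->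
    well_defined L sigma -> well_defined L tau ->
    exists pi, is_coupling (mu_pin L sigma) (mu_pin L tau) pi /\
               exp_disagree pi predT <= C.

Fixpoint walk_len (k : nat) (v u : V) : bool :=
  if k is k'.+1 then [exists w, walk_len k' v w && e w u] else u == v.

Definition in_sphere (l : nat) (v u : V) : bool :=
  walk_len l v u && [forall k : 'I_l, ~~ walk_len k v u].

End Gibbs.

(* Main.v *)
Require Import Defs.
From HB Require Import structures.
From mathcomp Require Import all_boot all_order all_algebra.
From mathcomp Require Import reals sequences exp.
From mathcomp Require Import lra ring.
Import Order.TTheory GRing.Theory Num.Theory.
Local Open Scope ring_scope.

(** Let f(N) be the best bound on the expected number of disagreements in a set
    at distance at least N from a flipped pinned vertex v. Take a coupling with
    at most C disagreements in all, and resample both configurations given their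
    restrictions x, y to the sphere S of radius l < N around v. Interpolating
    between x and y one vertex at a time is not available, because the
    intermediate pinnings need not be well defined. Instead, if x and y disagree
    on a set D of at least two vertices of S, unpin D in x one vertex at a time
    (each step is an average of single flips, of cost f(N - l)), then flip v
    with D free (cost f(N)), and pin D again as in y. If |D| <= 1, pin the whole
    ball inside S: what happens beyond S depends only on the values on S, so a
    single flip suffices. In all cases the cost is at most
    |D| (2 f(N - l) + f(N) / 2). The spheres of all radii l < N share the total
    budget C, of which v itself consumes 1, so one of them has few disagreements
    on average, and this yields f(N) <= C (1 - 2 / (5 C))^N, which is smaller than
    the required bound. *)

(** * Couplings as transport bounds for the Hamming distance on a set of vertices *)

Section Transport.
Set Implicit Arguments. Unset Strict Implicit.
Context {R : realType} {V : finType} {q : nat}.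
Local Notation config := (config V q).
Implicit Types (p : config -> R) (pi : config * config -> R) (T : pred V).
Implicit Types (x y z : config).

(** Wasserstein distance at most [B], for the Hamming metric counted on [T]. Stating it by existence
    avoids choosing an optimal coupling. *)
Definition transport_le T p1 p2 (B : R) : Prop :=
  exists pi, is_coupling p1 p2 pi /\ exp_disagree pi T <= B.

Definition dist T (x y : config) : R := #|[set u | T u & x u != y u]|%:R.

Lemma dist_sym T x y : dist T x y = dist T y x.
Proof. by congr (_%:R); apply: eq_card => u; rewrite !inE eq_sym. Qed.

Lemma dist_triangle T x y z : dist T x z <= dist T x y + dist T y z.
Proof.
rewrite /dist -natrD ler_nat (leq_trans _ (leq_card_setU _ _)) // subset_leq_card //.
apply/subsetP => u; rewrite !inE => /andP[-> xz] /=.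
by have [<-//|_] := eqVneq (x u) (y u).
Qed.

Lemma dist_eq0 T x y : (forall u, T u -> x u = y u) -> dist T x y = 0.
Proof.
move=> xy; rewrite /dist (_ : [set _ | _ & _] = set0) ?cards0 //.
by apply/setP => u; rewrite !inE; case: (boolP (T u)) => //= /xy ->; rewrite eqxx.
Qed.

Lemma big_config_pair (F : config * config -> R) :
  \sum_xy F xy = \sum_x \sum_y F (x, y).
Proof. by rewrite pair_bigA; apply: eq_bigr => -[]. Qed.

Lemma exp_disagreeE pi T :
  exp_disagree pi T = \sum_x \sum_y pi (x, y) * dist T x y.
Proof. exact: big_config_pair. Qed.

Lemma transport_leW T p1 p2 B B' :
  B <= B' -> transport_le T p1 p2 B -> transport_le T p1 p2 B'.
Proof. by move=> BB' [pi [cpi le_pi]]; exists pi; split=> //; exact: le_trans BB'. Qed.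

Lemma transport_le_sym T p1 p2 B :
  transport_le T p1 p2 B -> transport_le T p2 p1 B.
Proof.
move=> [pi [[pi0 [pi1 pi2]] le_pi]]; exists (fun xy => pi (xy.2, xy.1)); split.
  by split.
rewrite exp_disagreeE exchange_big /=; apply: le_trans le_pi.
rewrite exp_disagreeE.
by under eq_bigr do under eq_bigr do rewrite dist_sym.
Qed.

Lemma transport_le_ext T p1 p2 p1' p2' B : p1 =1 p1' -> p2 =1 p2' ->
  transport_le T p1 p2 B -> transport_le T p1' p2' B.
Proof.
move=> e1 e2 [pi [[pi0 [pi1 pi2]] le_pi]]; exists pi; split=> //; split=> //.
by split=> x; rewrite -?e1 -?e2.
Qed.

Lemma transport_le_map T p1 p2 (f : config -> config) :
    (forall x, 0 <= p1 x) ->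
    (forall y, \sum_(x | f x == y) p1 x = p2 y) ->
    (forall x u, T u -> x u = f x u) ->
  transport_le T p1 p2 0.
Proof.
move=> p1_ge0 p1f fT; exists (fun xy => if f xy.1 == xy.2 then p1 xy.1 else 0).
split; first split=> [xy|]; first by case: ifP.
  split=> [x|y] /=; last by rewrite -big_mkcond p1f.
  by rewrite -big_mkcond (big_pred1 (f x)) // => y; rewrite eq_sym.
rewrite exp_disagreeE big1 // => x _; rewrite big1 // => y _ /=.
by case: eqP => [<-|_]; rewrite ?mul0r // dist_eq0 ?mulr0 // => u /fT.
Qed.

Lemma transport_le_refl T p : (forall x, 0 <= p x) -> transport_le T p p 0.
Proof.
move=> p0; apply: (@transport_le_map _ _ _ id) => // y.
by rewrite (big_pred1 y).
Qed.

(** Gluing: given the middle configuration, draw the outer two independently, then apply the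
    triangle inequality to the resulting triple. *)
Lemma transport_le_trans T p1 p2 p3 B1 B2 :
  transport_le T p1 p2 B1 -> transport_le T p2 p3 B2 ->
  transport_le T p1 p3 (B1 + B2).
Proof.
move=> [pi [[pi0 [pi1 pi2]] le_pi]] [rho [[rho0 [rho1 rho2]] le_rho]].
have p20 y : 0 <= p2 y by rewrite -pi2 sumr_ge0.
have pi_eq0 x y : p2 y = 0 -> pi (x, y) = 0.
  by rewrite -pi2 => /psumr_eq0P; apply.
have rho_eq0 y z : p2 y = 0 -> rho (y, z) = 0.
  by rewrite -rho1 => /psumr_eq0P; apply.
have piK x y : pi (x, y) / p2 y * p2 y = pi (x, y).
  by have [/[dup] /pi_eq0 -> ->|/divfK->//] := eqVneq (p2 y) 0; rewrite mulr0.
have rhoK y z : rho (y, z) / p2 y * p2 y = rho (y, z).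
  by have [/[dup] /rho_eq0 -> ->|/divfK->//] := eqVneq (p2 y) 0; rewrite mulr0.
(* Where [p2 y = 0], both couplings vanish at [y], so the convention that division by 0 gives 0
   yields the right value. *)
pose tri x y z := pi (x, y) * rho (y, z) / p2 y.
have tri0 x y z : 0 <= tri x y z by rewrite divr_ge0 ?mulr_ge0.
have sum_z x y : \sum_z tri x y z = pi (x, y).
  by rewrite -mulr_suml -mulr_sumr rho1 mulrAC piK.
have sum_x y z : \sum_x tri x y z = rho (y, z).
  by rewrite -!mulr_suml pi2 -mulrA mulrC rhoK.
exists (fun xz => \sum_y tri xz.1 y xz.2); split; first split=> [xz|].
- by rewrite sumr_ge0.
- split=> [x|z] /=; rewrite exchange_big /=.
    by under eq_bigr do rewrite sum_z.
  by under eq_bigr do rewrite sum_x.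
apply: le_trans (lerD le_pi le_rho); rewrite !exp_disagreeE.
have -> : \sum_x \sum_y pi (x, y) * dist T x y =
    \sum_x \sum_z \sum_y tri x y z * dist T x y.
  apply: eq_bigr => x _; rewrite exchange_big /=; apply: eq_bigr => y _.
  by rewrite -mulr_suml sum_z.
have -> : \sum_y \sum_z rho (y, z) * dist T y z =
    \sum_x \sum_z \sum_y tri x y z * dist T y z.
  rewrite exchange_big [RHS]exchange_big /=; apply: eq_bigr => z _.
  rewrite exchange_big /=; apply: eq_bigr => y _.
  by rewrite -mulr_suml sum_x.
rewrite -big_split ler_sum //= => x _; rewrite -big_split ler_sum //= => z _.
rewrite mulr_suml -big_split ler_sum //= => y _.
by rewrite -mulrDr ler_wpM2l ?dist_triangle.
Qed.

Lemma transport_le_mix T (I : finType) (w : I -> R) (p p' : I -> config -> R)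
    (B : I -> R) :
    (forall i, 0 <= w i) ->
    (forall i, 0 < w i -> transport_le T (p i) (p' i) (B i)) ->
  transport_le T (fun x => \sum_i w i * p i x) (fun x => \sum_i w i * p' i x)
    (\sum_i w i * B i).
Proof.
move=> w0 tr.
(* One coupling per index; an index of weight 0 gets the zero function, which contributes nothing to
   the mixture. *)
have /fin_all_exists[pi piP] i : exists pi, 0 < w i ->
    is_coupling (p i) (p' i) pi /\ exp_disagree pi T <= B i.
  have [/tr[pi piP]|] := ltP 0 (w i); first by exists pi.
  by exists (fun=> 0).
have wP (i : I) : w i = 0 \/ 0 < w i.
  by move: (w0 i); rewrite le_eqVlt => /orP[/eqP|]; [left|right].
exists (fun xy => \sum_i w i * pi i xy); split; first split=> [xy|].
- apply: sumr_ge0 => i _; have [->|/[dup] wi /piP[[pi0 _] _]] := wP i.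
    by rewrite mul0r.
  by rewrite mulr_ge0.
- split=> [x|y]; rewrite exchange_big; apply: eq_bigr => i _ /=;
    rewrite -mulr_sumr; have [->|/piP[[_ [pi1 pi2]] _]] := wP i;
    by rewrite ?mul0r // ?pi1 ?pi2.
rewrite /exp_disagree; under eq_bigr do rewrite mulr_suml.
rewrite exchange_big ler_sum //= => i _.
under eq_bigr do rewrite -mulrA.
rewrite -mulr_sumr; have [->|/[dup] wi /piP[_ le_pi]] := wP i.
  by rewrite !mul0r.
by rewrite ler_wpM2l.
Qed.

End Transport.

(** * Pinned Gibbs measures and their consistency under resampling *)

Section GibbsMeasure.
Set Implicit Arguments. Unset Strict Implicit.
Context {R : realType} {V : finType} {q : nat}.
Variables (e : rel V) (AE : 'I_q -> 'I_q -> R) (AV : 'I_q -> R).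
Hypothesis AE_ge0 : forall a b, 0 <= AE a b.
Hypothesis AV_ge0 : forall a, 0 <= AV a.

Local Notation config := (config V q).
Local Notation wt := (pin_weight e AE AV).
Local Notation mu := (mu_pin e AE AV).
Local Notation wd := (well_defined e AE AV).
Implicit Types (L M : {set V}) (sigma tau : V -> 'I_q) (x y z : config).

Lemma pin_weight_ge0 L sigma x : 0 <= wt L sigma x.
Proof.
rewrite /pin_weight mulr_ge0 ?mulr_ge0 ?prodr_ge0 //; first by case: ifP.
by move=> u _; rewrite prodr_ge0.
Qed.

Lemma eq_pin_weight L sigma tau :
  {in L, sigma =1 tau} -> wt L sigma =1 wt L tau.
Proof.
move=> st x; congr (_ * _ * _); congr (if _ then _ else _).
by apply: eq_forallb_in => v vL; rewrite st.
Qed.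

Lemma eq_mu_pin L sigma tau : {in L, sigma =1 tau} -> mu L sigma =1 mu L tau.
Proof.
move=> /eq_pin_weight st x; rewrite /mu_pin /pin_Z st.
by congr (_ / _); apply: eq_bigr.
Qed.

Lemma pin_weight_neq0 L sigma x :
  reflect [/\ {in L, x =1 sigma}, forall v, v \notin L -> AV (x v) != 0 &
      forall u v, edge_or e u v -> ~~ ((u \in L) && (v \in L)) ->
        AE (x u) (x v) != 0]
    (wt L sigma x != 0).
Proof.
rewrite /pin_weight !mulf_eq0 !negb_or -andbA.
apply: (iffP and3P) => -[xs xV xE]; split.
- by move: xs; case: forall_inP => [xs _ v /xs/eqP|]; rewrite ?eqxx.
- exact/prodf_neq0.
- move=> u v uv uvL; move/prodf_neq0: xE => /(_ u isT)/prodf_neq0; apply.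
  by rewrite uv.
- rewrite ifT ?oner_eq0 //; apply/forall_inP => v /xs ->; exact: eqxx.
- exact/prodf_neq0.
- apply/prodf_neq0 => u _; apply/prodf_neq0 => v /andP[]; exact: xE.
Qed.

Lemma pin_weight_wd L sigma x : wt L sigma x != 0 -> wd L sigma.
Proof.
move=> wx; have {}wx : 0 < wt L sigma x by rewrite lt_neqAle eq_sym wx pin_weight_ge0.
rewrite /well_defined /pin_Z (bigD1 x) //= ltr_pwDl // sumr_ge0 // => z _.
exact: pin_weight_ge0.
Qed.

Lemma mu_pin_ge0 L sigma x : 0 <= mu L sigma x.
Proof.
by rewrite /mu_pin divr_ge0 ?sumr_ge0 // => *; exact: pin_weight_ge0.
Qed.

Lemma mu_pin_gt0 L sigma x : 0 < mu L sigma x -> wt L sigma x != 0.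
Proof. by apply: contraTneq; rewrite /mu_pin => ->; rewrite mul0r ltxx. Qed.

Lemma sum_mu_pin L sigma : wd L sigma -> \sum_x mu L sigma x = 1.
Proof. by move=> wdL; rewrite -mulr_suml divff // lt0r_neq0. Qed.

(** Pinning more vertices to their values in [x] only drops factors. Hence every pinning read off a
    sampled configuration is well defined. *)
Lemma pin_weight_mono L M sigma x :
  L \subset M -> wt L sigma x != 0 -> wt M x x != 0.
Proof.
move=> /subsetP LM /pin_weight_neq0[_ xV xE]; apply/pin_weight_neq0; split=> //.
  by move=> v vM; apply: xV; apply: contra vM; exact: LM.
move=> u v uv uvM; apply: xE => //; apply: contra uvM => /andP[uL vL].
by rewrite !LM.
Qed.

(** Both sides vanish unless [x] and [z] agree on [M]. In that case the factors dropped by pinning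
    [M] have the same value at [x] and at [z], and the others occur once for each of the two. *)
Lemma pin_weight_detailed_balance L M sigma x z : L \subset M ->
  wt L sigma x * wt M x z = wt L sigma z * wt M z x.
Proof.
move=> /subsetP LM.
have sym : [forall v in M, z v == x v] = [forall v in M, x v == z v].
  by apply: eq_forallb_in => v _; rewrite eq_sym.
rewrite /pin_weight sym; have [/forall_inP xz|_] := boolP [forall v in M, x v == z v];
  last by rewrite !(mul0r, mulr0).
have {}xz v : v \in M -> x v = z v by move=> /xz/eqP.
have -> : [forall v in L, x v == sigma v] = [forall v in L, z v == sigma v].
  by apply: eq_forallb_in => v /LM/xz ->.
set s := if _ then _ else _; rewrite !mul1r -!mulrA; congr (s * _).
rewrite mulrA [RHS]mulrA mulrACA [RHS]mulrACA; congr (_ * _).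
  rewrite !(big_mkcond (fun v => v \notin _)) -!big_split /=.
  apply: eq_bigr => v _; have [vL|vL] := boolP (v \in L).
    by rewrite LM.
  by have [/xz ->|] := boolP (v \in M); rewrite ?mulr1 //= mulrC.
rewrite -!big_split; apply: eq_bigr => u _ /=.
rewrite !(big_mkcond (fun v => edge_or _ _ _ && _)) -!big_split /=.
apply: eq_bigr => v _; case: (edge_or e u v) => //=.
have [/andP[uM vM]|uvM] := boolP ((u \in M) && (v \in M)).
  by rewrite !xz.
have /negbTE -> : ~~ ((u \in L) && (v \in L)).
  by apply: contra uvM => /andP[uL vL]; rewrite !LM.
by rewrite mulrC.
Qed.

Lemma mu_pin_tower L M sigma z : L \subset M -> wd L sigma ->
  \sum_x mu L sigma x * mu M x z = mu L sigma z.
Proof.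
move=> LM wdL.
have -> : \sum_x mu L sigma x * mu M x z =
    \sum_x mu L sigma z * mu M z x.
  apply: eq_bigr => x _; rewrite /mu_pin mulrACA [RHS]mulrACA.
  rewrite pin_weight_detailed_balance //.
  have [wzx|wzx] := eqVneq (wt M z x) 0; first by rewrite wzx mulr0 !mul0r.
  have /pin_weight_neq0[xz _ _] := wzx.
  (* As [x] and [z] agree on [M], they define the same normaliser. *)
  by congr (_ * (_ * _^-1)); apply: eq_bigr => y _; rewrite (eq_pin_weight xz).
rewrite -mulr_sumr; have [wz|wz] := eqVneq (wt L sigma z) 0.
  by rewrite /mu_pin wz !mul0r.
by rewrite sum_mu_pin ?mulr1 //; apply/(@pin_weight_wd _ _ z)/(pin_weight_mono LM wz).
Qed.

End GibbsMeasure.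

(** * Graph distance through walks, spheres and open balls *)

Section Walks.
Set Implicit Arguments. Unset Strict Implicit.
Context {V : finType} (e : rel V).
Implicit Types (u v w : V) (T : pred V).

(** Distance at least [m] expressed by the absence of shorter walks, so that unreachable vertices
    count as infinitely far. *)
Definition beyond m v T := forall j u, (j < m)%N -> T u -> ~~ walk_len e j v u.

Lemma walk_len_cat i j u v w :
  walk_len e i u v -> walk_len e j v w -> walk_len e (i + j) u w.
Proof.
move=> uv; elim: j w => [|j IH] w; first by rewrite addn0 => /eqP ->.
rewrite addnS /= => /existsP[t /andP[/IH ut tw]].
by apply/existsP; exists t; rewrite ut.
Qed.

Lemma beyond_sub m l u v T :
  walk_len e l v u -> beyond m v T -> beyond (m - l) u T.
Proof.
move=> vu mT j w jm Tw; apply: contra (mT (l + j)%N w _ Tw); last by rewrite -ltn_subRL.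
exact: walk_len_cat.
Qed.

Lemma in_sphere_self l v : in_sphere e l v v = (l == 0)%N.
Proof.
case: l => [|l]; rewrite /in_sphere /= ?eqxx /=; first by apply/forallP => -[].
by apply/negbTE/nandP; right; apply/forallPn; exists ord0; rewrite /= eqxx.
Qed.

Lemma in_sphere_inj l m v u : in_sphere e l v u -> in_sphere e m v u -> l = m.
Proof.
move=> /andP[lu /forallP nl] /andP[mu /forallP nm].
have [lm|ml|//] := ltngtP l m.
  by have := nm (Ordinal lm); rewrite /= lu.
by have := nl (Ordinal ml); rewrite /= mu.
Qed.

Definition inner_ball l v : {set V} := [set u | [exists j : 'I_l, walk_len e j v u]].

Lemma inner_ballP l v u :
  reflect (exists2 j, (j < l)%N & walk_len e j v u) (u \in inner_ball l v).
Proof.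
rewrite inE; apply: (iffP existsP) => [[j vu]|[j jl vu]]; first by exists j.
by exists (Ordinal jl).
Qed.

(** The sphere separates the open ball from the rest of the graph; this is what lets the pinned
    sphere screen off the ball. *)
Lemma inner_ball_edge l v u w : u \in inner_ball l v -> e u w ->
  (w \in inner_ball l v) || in_sphere e l v w.
Proof.
move=> /inner_ballP[j jl vu] uw.
have [//|wI /=] := boolP (w \in inner_ball l v).
have vw : walk_len e j.+1 v w by rewrite /=; apply/existsP; exists u; rewrite vu.
have jl' : j.+1 = l.
  apply/eqP; rewrite eqn_leq jl leqNgt; apply: contra wI => jl'.
  by apply/inner_ballP; exists j.+1.
apply/andP; split; first by rewrite -jl'.
by apply/forallP => k; apply: contra wI => vwk; apply/inner_ballP; exists k.
Qed.

End Walks.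

(** * Comparing pinned measures by resampling on a sphere *)

Section Resampling.
Set Implicit Arguments. Unset Strict Implicit.
Context {R : realType} {V : finType} {q : nat}.
Variables (e : rel V) (AE : 'I_q -> 'I_q -> R) (AV : 'I_q -> R).
Hypothesis e_sym : symmetric e.
Hypothesis AE_ge0 : forall a b, 0 <= AE a b.
Hypothesis AV_ge0 : forall a, 0 <= AV a.

Local Notation config := (config V q).
Local Notation wt := (pin_weight e AE AV).
Local Notation mu := (mu_pin e AE AV).
Local Notation wd := (well_defined e AE AV).
Implicit Types (L M : {set V}) (sigma tau : V -> 'I_q) (x y z : config).
Implicit Types (T : pred V).

Local Notation mono := pin_weight_mono.
Let wt_wd L sigma x (wx : wt L sigma x != 0) : wd L sigma :=
  pin_weight_wd AE_ge0 AV_ge0 wx.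
Let mu_ge0 := mu_pin_ge0 e AE_ge0 AV_ge0.

Lemma mu_pin_agree T L sigma tau :
  {in L, sigma =1 tau} -> transport_le T (mu L sigma) (mu L tau) 0.
Proof.
move=> st; apply: (transport_le_ext _ _ (transport_le_refl T (mu_ge0 L sigma))) => //.
exact: eq_mu_pin.
Qed.

(** By the tower property both measures are mixtures, with the same weights [pi], of measures pinned
    on [M]; transport bounds average over mixtures. *)
Lemma transport_le_resample T L1 L2 M sigma tau pi (B : config * config -> R) :
    is_coupling (mu L1 sigma) (mu L2 tau) pi ->
    L1 \subset M -> L2 \subset M -> wd L1 sigma -> wd L2 tau ->
    (forall x y, wt L1 sigma x != 0 -> wt L2 tau y != 0 ->
       transport_le T (mu M x) (mu M y) (B (x, y))) ->
  transport_le T (mu L1 sigma) (mu L2 tau) (\sum_xy pi xy * B xy).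
Proof.
move=> [pi0 [pi1 pi2]] L1M L2M wd1 wd2 trB.
apply: (transport_le_ext _ _ (@transport_le_mix _ _ _ T _ pi
  (fun xy => mu M xy.1) (fun xy => mu M xy.2) B pi0 _)).
- move=> z; rewrite -(mu_pin_tower AE_ge0 AV_ge0 z L1M wd1).
  rewrite big_config_pair /=.
  by apply: eq_bigr => x _; rewrite -mulr_suml pi1.
- move=> z; rewrite -(mu_pin_tower AE_ge0 AV_ge0 z L2M wd2).
  rewrite big_config_pair exchange_big /=.
  by apply: eq_bigr => x _; rewrite -mulr_suml pi2.
move=> [x y] pixy; apply: trB; apply: mu_pin_gt0.
  by rewrite -pi1 (lt_le_trans pixy) // (bigD1 y) //= lerDl sumr_ge0.
by rewrite -pi2 (lt_le_trans pixy) // (bigD1 x) //= lerDl sumr_ge0.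
Qed.

Lemma transport_le_resample_indep T L1 L2 M sigma tau (B : R) :
    L1 \subset M -> L2 \subset M -> wd L1 sigma -> wd L2 tau ->
    (forall x y, wt L1 sigma x != 0 -> wt L2 tau y != 0 ->
       transport_le T (mu M x) (mu M y) B) ->
  transport_le T (mu L1 sigma) (mu L2 tau) B.
Proof.
move=> L1M L2M wd1 wd2 trB.
pose pi xy : R := mu L1 sigma xy.1 * mu L2 tau xy.2.
have cpi : is_coupling (mu L1 sigma) (mu L2 tau) pi.
  split=> [xy|]; first by rewrite mulr_ge0.
  split=> x; rewrite /pi /=; first by rewrite -mulr_sumr sum_mu_pin ?mulr1.
  by rewrite -mulr_suml sum_mu_pin ?mul1r.
have := transport_le_resample (B := fun=> B) cpi L1M L2M wd1 wd2 trB.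
apply: transport_leW; rewrite -mulr_suml big_config_pair /=.
rewrite /pi /=; under eq_bigr do rewrite -mulr_sumr sum_mu_pin // mulr1.
by rewrite sum_mu_pin // mul1r.
Qed.

(** This says f(m) <= [B]. It is uniform in the pinned set, the flipped vertex and [T], because the
    recursion changes the first two. *)
Definition flip_bound m (B : R) := forall L sigma tau v T,
  differ_only_at L sigma tau v -> wd L sigma -> wd L tau -> beyond e m v T ->
  transport_le T (mu L sigma) (mu L tau) B.

(** Leaving [u] free amounts to pinning it to a random value of positive probability, so each term
    of the average is no change or a single flip at [u] between well-defined pinnings. *)
Lemma flip_bound_unpin1 T m B L x u : flip_bound m B -> 0 <= B ->
  wt L x x != 0 -> beyond e m u T -> transport_le T (mu (u |: L) x) (mu L x) B.
Proof.
move=> flipB B0 wx uT; have LM : L \subset u |: L by exact: subsetUr.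
have wMx := mono LM wx.
apply: (transport_le_resample_indep (M := u |: L)) => //.
- exact: wt_wd wMx.
- exact: wt_wd wx.
move=> x' y wx' wy; have /pin_weight_neq0[x'x _ _] := wx'.
have /pin_weight_neq0[yx _ _] := wy.
have [xyu|xyu] := eqVneq (x' u) (y u).
  apply: (transport_leW B0); apply: mu_pin_agree => w /[dup] wM.
  by case/setU1P => [->//|wL]; rewrite yx ?x'x.
apply: (flipB _ _ _ u) => //;
  [split=> [|]|exact/wt_wd/(mono _ wx')|exact/wt_wd/(mono _ wy)].
  exact: setU11.
by split=> // w /[dup] wM /setU1P[->|wL _]; [rewrite eqxx|rewrite yx ?x'x].
Qed.

Lemma flip_bound_unpin T m B L (D : {set V}) x : flip_bound m B -> 0 <= B ->
    wt L x x != 0 -> (forall u, u \in D -> beyond e m u T) ->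
  transport_le T (mu (L :|: D) x) (mu L x) (#|D|%:R * B).
Proof.
move=> flipB B0 wx; move cardD: #|D| => n; elim: n D cardD => [|n IH] D cardD DT.
  by rewrite mul0r (cards0_eq cardD) setU0; exact: mu_pin_agree.
have [u uD] : exists u, u \in D by apply/set0Pn; rewrite -card_gt0 cardD.
have DE : L :|: D = u |: (L :|: D :\ u) by rewrite setUCA setD1K.
rewrite DE -natr1 mulrDl mul1r addrC; apply: transport_le_trans.
  apply: (flip_bound_unpin1 flipB) => //; last exact: DT.
  exact: mono (subsetUl _ _) wx.
apply: IH => [|w /setD1P[_ /DT //]].
by move: cardD; rewrite (cardsD1 u) uD => -[].
Qed.

Definition patch (I : {set V}) y z : config := [ffun u => if u \in I then y u else z u].

Section Patch.
Variables (M I : {set V}) (x y : config).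
Hypothesis IM : I \subset M.
Hypothesis I_edge : forall u w, u \in I -> e u w -> w \in M.
Hypothesis xy : {in M :\: I, x =1 y}.

(** Markov property: all neighbours of [I] are pinned, so every edge touching [I] has both ends in
    [M] and is dropped from the weight. The values on [I] then enter only through the indicator. *)
Lemma pin_weight_patch z :
  {in I, z =1 x} -> wt M x z = wt M y (patch I y z).
Proof.
move=> zx; congr (_ * _ * _).
- congr (if _ then _ else _); apply: eq_forallb_in => v vM; rewrite ffunE.
  by have [/zx ->|vI] := boolP (v \in I); rewrite ?eqxx // xy // inE vI.
- apply: eq_bigr => v vM; rewrite ffunE ifN //.
  by apply: contra vM; exact: (subsetP IM).
apply: eq_bigr => u _; apply: eq_bigr => w /andP[/andP[uw _] uwM].
rewrite !ffunE !ifN //; apply: contra uwM => inI.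
  by rewrite (subsetP IM w) // (I_edge inI) // e_sym.
by rewrite (subsetP IM u) // (I_edge inI).
Qed.

Lemma sum_pin_weight_patch z' :
  \sum_(z | patch I y z == z') wt M x z = wt M y z'.
Proof.
have [|yz'] := boolP [forall u in I, z' u == y u]; last first.
  rewrite big_pred0 => [|z]; last first.
    apply: contraNF yz' => /eqP <-; apply/forall_inP => u uI.
    by rewrite ffunE uI.
  apply/esym/eqP; apply: contraNT yz' => /pin_weight_neq0[yz' _ _].
  by apply/forall_inP => u uI; rewrite yz' // (subsetP IM).
move=> /forall_inP yz'.
have patchK : patch I y (patch I x z') = z'.
  by apply/ffunP => u; rewrite !ffunE; have [/yz'/eqP|] := boolP (u \in I).
(* On the support [z] must equal [x] on [I], so [patch I x z'] is the only preimage of [z'] that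
   contributes. *)
rewrite (bigD1 (patch I x z')) ?patchK //= big1 ?addr0.
  by rewrite pin_weight_patch ?patchK // => u uI; rewrite ffunE uI.
move=> z /andP[/eqP zz' neq]; apply/eqP; apply: contraNT neq.
move=> /pin_weight_neq0[zx _ _]; apply/eqP/ffunP => u; rewrite ffunE.
have [uI|uI] := boolP (u \in I); first by rewrite zx // (subsetP IM).
by rewrite -zz' ffunE (negbTE uI).
Qed.

Lemma transport_le_patch T :
  (forall u, T u -> u \notin I) -> transport_le T (mu M x) (mu M y) 0.
Proof.
move=> TI; apply: (transport_le_map (f := patch I y)) => //.
- move=> z'; rewrite -mulr_suml sum_pin_weight_patch /mu_pin; congr (_ / _).
  rewrite /pin_Z (partition_big (patch I y) xpredT) //=.
  by apply: eq_bigr => z _; rewrite sum_pin_weight_patch.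
by move=> z u /TI uI; rewrite ffunE (negbTE uI).
Qed.

End Patch.

Lemma flip_bound_patch T m B (M I : {set V}) x y u :
    flip_bound m B -> 0 <= B -> wt M x x != 0 -> wt M y y != 0 ->
    I \subset M -> (forall v w, v \in I -> e v w -> w \in M) ->
    (forall w, T w -> w \notin I) ->
    u \in M :\: I -> beyond e m u T ->
    (forall w, w \in M :\: I -> w != u -> x w = y w) ->
  transport_le T (mu M x) (mu M y) ((x u != y u)%:R * B).
Proof.
move=> flipB B0 wx wy IM I_edge TI /[dup] uMI /setDP[uM uI] uT xy.
(* On [M], [y'] can differ from [x] only at [u]. It differs from [y] only inside [I], where a change
   is free for [T]. *)
pose y' := patch I x y.
have yy' : {in M :\: I, y =1 y'}.
  by move=> w /setDP[_ wI]; rewrite ffunE (negbTE wI).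
have y'E w : w \in M -> w != u -> x w = y' w.
  move=> wM wu; rewrite ffunE; have [//|wI] := boolP (w \in I).
  by rewrite xy // inE wI.
have y'u : y' u = y u by rewrite -yy'.
rewrite -[_ * B]addr0; apply: (transport_le_trans (p2 := mu M y')); last first.
  by apply: transport_le_sym; exact: (transport_le_patch IM I_edge yy').
have [xyu|xyu] := eqVneq (x u) (y u).
  rewrite mul0r; apply: mu_pin_agree => w wM.
  have [->|/(y'E _ wM)//] := eqVneq w u.
  by rewrite y'u xyu.
rewrite mul1r; apply: (flipB _ _ _ u) => //; [|exact: wt_wd wx|].
  by split=> //; split; rewrite ?y'u.
(* The pinning by [y'] is well defined because patching turns the positive weight of [y] into that
   of [y']. *)
apply: (@wt_wd _ _ y'); move: wy; rewrite (pin_weight_patch IM I_edge yy') //.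
rewrite (_ : patch I y' y = y') //; apply/ffunP => w; rewrite !ffunE.
by case: (w \in I).
Qed.

Lemma flip_bound_sphere T (N l : nat) (phi B : R) L sigma tau v x y :
    let S := [set u | in_sphere e l v u] in
    (0 < l < N)%N -> flip_bound (N - l) phi -> flip_bound N B ->
    0 <= phi -> 0 <= B -> differ_only_at L sigma tau v -> beyond e N v T ->
    wt L sigma x != 0 -> wt L tau y != 0 ->
  transport_le T (mu (L :|: S) x) (mu (L :|: S) y)
    (dist (in_sphere e l v) x y * (2 * phi + B / 2)).
Proof.
move=> S /andP[l0 lN] flip_phi flipB phi0 B0 [vL [stv st]] vT wx wy.
have [xs _ _] := pin_weight_neq0 _ _ _ _ _ _ wx.
have [yt _ _] := pin_weight_neq0 _ _ _ _ _ _ wy.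
pose D := [set u | in_sphere e l v u & x u != y u].
have LS : L \subset L :|: S := subsetUl _ _.
have vS : v \notin S by rewrite inE in_sphere_self -lt0n l0.
have vI : v \in inner_ball e l v by apply/inner_ballP; exists 0%N; rewrite //= eqxx.
have xyL u : u \in L -> u != v -> x u = y u.
  by move=> uL uv; rewrite xs // yt // st.
have DT u : u \in D -> beyond e (N - l) u T.
  by rewrite inE => /andP[/andP[vu _] _]; exact: beyond_sub vu vT.
have [D2|D1] := leqP 2 #|D|.
  pose A := L :|: (S :\: D).
  have LA : L \subset A := subsetUl _ _.
  have -> : L :|: S = A :|: D.
    rewrite -setUA; congr (_ :|: _); apply/setP => u.
    by rewrite !inE; case: in_sphere => //=; case: eqP.
  have vA : v \in A by rewrite (subsetP LA).
  have trx := flip_bound_unpin flip_phi phi0 (mono LA wx) DT.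
  have tr_y := flip_bound_unpin flip_phi phi0 (mono LA wy) DT.
  (* With [D] free, the pinnings by [x] and [y] differ only at [v], so this is one flip at distance
     [N]. *)
  have trv : transport_le T (mu A x) (mu A y) B.
    apply: (flipB _ _ _ v) => //; try exact/wt_wd/mono/wx; try exact/wt_wd/mono/wy.
    split=> //; split=> [|u /setUP[/xyL//|]]; first by rewrite xs // yt.
    by rewrite !inE => /andP[+ uS]; rewrite uS /= negbK => /eqP.
  have := transport_le_trans (transport_le_trans trx trv) (transport_le_sym tr_y).
  apply: transport_leW; rewrite /dist -/D.
  (* The flip of [v] is shared by at least two vertices of [D], so [B] is at most |D| times
     [B / 2]. *)
  have : 2 <= #|D|%:R :> R by rewrite ler_nat.
  nra.
have wLSx := mono LS wx; have wLSy := mono LS wy.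
(* The ball contains [v], so the only disagreement left outside it is at the vertex of [D], if there
   is one. *)
pose M := (L :|: S) :|: inner_ball e l v.
apply: (transport_le_resample_indep (M := M)); rewrite ?subsetUl //.
- exact: wt_wd wLSx.
- exact: wt_wd wLSy.
move=> x' y' wx' wy'.
have [xx' _ _] := pin_weight_neq0 _ _ _ _ _ _ wx'.
have [yy' _ _] := pin_weight_neq0 _ _ _ _ _ _ wy'.
have wMx' := mono (subsetUl _ (inner_ball e l v)) wx'.
have wMy' := mono (subsetUl _ (inner_ball e l v)) wy'.
have IM : inner_ball e l v \subset M := subsetUr _ _.
have I_edge u w : u \in inner_ball e l v -> e u w -> w \in M.
  by move=> uI /(inner_ball_edge uI)/orP[wI|wS]; rewrite 2!in_setU ?wI ?orbT //
    [w \in S]inE wS orbT.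
have TI u : T u -> u \notin inner_ball e l v.
  move=> Tu; apply/inner_ballP => -[j jl].
  by apply/negP/vT => //; exact: ltn_trans lN.
have xyMI w : w \in M :\: inner_ball e l v -> w \notin D -> x' w = y' w.
  case/setDP => /setUP[wLS|->//] wI wD; rewrite xx' // yy' //.
  case/setUP: wLS => [wL|]; last first.
    by move: wD; rewrite !inE => + wS; rewrite wS /= negbK => /eqP.
  by apply: xyL => //; apply: contraNneq wI => ->.
have [D0|[u uD]] := set_0Vmem D.
  rewrite /dist -/D D0 cards0 mul0r.
  by apply: (transport_le_patch IM I_edge _ TI) => w wMI; apply: xyMI; rewrite // D0 inE.
have DE : D = [set u].
  by apply/eqP; rewrite eq_sym eqEcard sub1set uD cards1.
have uS : u \in S by move: uD; rewrite !inE => /andP[].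
have uMI : u \in M :\: inner_ball e l v.
  rewrite inE !in_setU uS orbT andbT; apply/inner_ballP => -[j jl].
  by move: uS; rewrite inE => /andP[_ /forallP/(_ (Ordinal jl))/negP].
rewrite /dist -/D DE cards1 mul1r.
have := flip_bound_patch flip_phi phi0 wMx' wMy' IM I_edge TI uMI (DT u uD) _.
have /[swap]/[apply] : forall w, w \in M :\: inner_ball e l v -> w != u -> x' w = y' w.
  by move=> w wMI wu; apply: xyMI => //; rewrite DE inE.
apply: transport_leW; case: (x' u != y' u); rewrite ?mul1r ?mul0r; lra.
Qed.

Lemma flip_bound_via_sphere T (N l : nat) (phi B : R) L sigma tau v pi :
    (0 < l < N)%N -> flip_bound (N - l) phi -> flip_bound N B ->
    0 <= phi -> 0 <= B -> differ_only_at L sigma tau v ->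
    wd L sigma -> wd L tau -> beyond e N v T ->
    is_coupling (mu L sigma) (mu L tau) pi ->
  transport_le T (mu L sigma) (mu L tau)
    (exp_disagree pi (in_sphere e l v) * (2 * phi + B / 2)).
Proof.
move=> lN flip_phi flipB phi0 B0 diff wds wdt vT cpi.
have := @transport_le_resample T L L (L :|: [set u | in_sphere e l v u]) sigma tau pi
  (fun xy => dist (in_sphere e l v) xy.1 xy.2 * (2 * phi + B / 2)) cpi.
rewrite subsetUl => /(_ isT isT wds wdt _)/wrap[].
  by move=> x y; apply: flip_bound_sphere diff vT.
by apply: transport_leW; rewrite /exp_disagree mulr_suml; under eq_bigr do rewrite mulrA.
Qed.

End Resampling.

(** * Disagreement probabilities and total variation *)

Section Disagreement.
Set Implicit Arguments. Unset Strict Implicit.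
Context {R : realType} {V : finType} {q : nat}.
Local Notation config := (config V q).
Implicit Types (p : config -> R) (pi : config * config -> R) (T : pred V).

Definition disagree_prob pi u : R := \sum_xy pi xy * (xy.1 u != xy.2 u)%:R.

Lemma disagree_prob_ge0 pi u : (forall xy, 0 <= pi xy) -> 0 <= disagree_prob pi u.
Proof. by move=> pi0; rewrite sumr_ge0 // => xy _; rewrite mulr_ge0. Qed.

Lemma exp_disagree_sum pi T : exp_disagree pi T = \sum_(u | T u) disagree_prob pi u.
Proof.
rewrite exchange_big; apply: eq_bigr => xy _; rewrite -mulr_sumr; congr (_ * _).
by rewrite -natr_sum -big_mkcondr sum1dep_card.
Qed.

Lemma exp_disagree_le pi T : (forall xy, 0 <= pi xy) ->
  exp_disagree pi T <= exp_disagree pi predT.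
Proof.
move=> pi0; rewrite !exp_disagree_sum [leRHS](bigID T) /= lerDl.
by rewrite sumr_ge0 // => u _; exact: disagree_prob_ge0.
Qed.

(** The spheres of radius below [N] and the set [T] are pairwise disjoint, so no vertex is counted
    twice. *)
Lemma exp_disagree_spheres (e : rel V) pi T N v : (forall xy, 0 <= pi xy) ->
    beyond e N v T ->
  \sum_(l < N) exp_disagree pi (in_sphere e l v) + exp_disagree pi T
    <= exp_disagree pi predT.
Proof.
move=> pi0 vT; under eq_bigr do rewrite exp_disagree_sum big_mkcond.
rewrite !exp_disagree_sum exchange_big /= (big_mkcond T) -big_split ler_sum //= => u _.
have p0 := disagree_prob_ge0 u pi0.
have [Tu|_] := boolP (T u).
  rewrite big1 ?add0r // => l _.
  by rewrite /in_sphere (negbTE (vT l u (ltn_ord l) Tu)).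
rewrite addr0; have [l vl|nol] := pickP (fun l : 'I_N => in_sphere e l v u); last first.
  by rewrite big1 // => l _; rewrite nol.
rewrite (bigD1 l) //= vl big1 ?addr0 // => m ml; rewrite ifN //.
by apply: contra ml => vm; apply/eqP/val_inj/(in_sphere_inj vm vl).
Qed.

Lemma marginal_dist_le p1 p2 pi u : is_coupling p1 p2 pi ->
  2^-1 * \sum_(c : 'I_q)
     `|\sum_(x : config | x u == c) p1 x - \sum_(x : config | x u == c) p2 x|
    <= disagree_prob pi u.
Proof.
move=> [pi0 [pi1 pi2]].
rewrite mulrC ler_pdivrMr // mulr_suml.
have diffE c : \sum_(x : config | x u == c) p1 x - \sum_(x : config | x u == c) p2 x =
    \sum_xy pi xy * ((xy.1 u == c)%:R - (xy.2 u == c)%:R).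
  under [RHS]eq_bigr do rewrite mulrBr.
  rewrite sumrB !big_config_pair [X in _ = _ - X]exchange_big /=.
  congr (_ - _); rewrite big_mkcond; apply: eq_bigr => x _; rewrite -mulr_suml.
    by rewrite pi1; case: eqP; rewrite ?mulr1 ?mulr0.
  by rewrite pi2; case: eqP; rewrite ?mulr1 ?mulr0.
under eq_bigr do rewrite diffE.
apply: le_trans (ler_sum _ (fun c _ => ler_norm_sum _ _ _)) _.
rewrite exchange_big ler_sum //= => -[x y] _ /=.
under eq_bigr do rewrite normrM (ger0_norm (pi0 _)).
rewrite -mulr_sumr -mulrA ler_wpM2l //.
have [xyu|xyu] := eqVneq (x u) (y u).
  by rewrite mul0r big1 // => c _; rewrite xyu subrr normr0.
(* Only the colours [x u] and [y u] contribute, 1 each; the total 2 cancels the factor 1/2 of total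
   variation. *)
rewrite mul1r (bigD1 (x u)) //= (bigD1 (y u)) /=; last by rewrite eq_sym.
rewrite !eqxx.
rewrite big1 ?addr0 => [|c /andP[cx cy]].
  rewrite (eq_sym (y u)) (negbTE xyu) subr0 sub0r normrN normr1; lra.
by rewrite (eq_sym (x u)) (negbTE cx) (eq_sym (y u)) (negbTE cy) subrr normr0.
Qed.

End Disagreement.

(** * The geometric rate and its comparison with powers of 1/2 *)

Section DecayRate.
Set Implicit Arguments. Unset Strict Implicit.
Context {R : realType}.
Variable C : R.
Hypothesis C1 : 1 <= C.

(** Here 2/5 = 1 / (2 + 1/2) is the reciprocal of the cost coefficients of one disagreement. The
    rate makes the thresholds (2/5) [rate]^l telescope in [sum_rate]. *)
Definition rate : R := 1 - 2 / (5 * C).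

Let C_gt0 : 0 < C. Proof. exact: lt_le_trans C1. Qed.

Lemma rate_defect : 2 / 5 + C * rate = C.
Proof. by rewrite /rate; field; rewrite lt0r_neq0. Qed.

Lemma rate_gt0 : 0 < rate.
Proof. by rewrite -(pmulr_rgt0 _ C_gt0); have := rate_defect; move: C1; lra. Qed.

Lemma rate_le1 : rate <= 1.
Proof. by rewrite -(ler_pM2l C_gt0); have := rate_defect; lra. Qed.

Lemma sum_rate n :
  \sum_(i < n) (2 / 5) * rate ^+ i.+1 + C * rate ^+ n.+1 = C * rate.
Proof.
elim: n => [|n IH]; first by rewrite big_ord0 add0r.
rewrite big_ord_recr /= -[RHS]IH -addrA; congr (_ + _).
rewrite [in C * _]exprS mulrA -mulrDl; congr (_ * _); exact: rate_defect.
Qed.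

Lemma rate_decay N : (0 < N)%N ->
  C * rate ^+ N <= 2 * C * (2^-1) ^ (Num.ceil (N%:R / (2 * C))).
Proof.
move=> N0; set c := Num.ceil _.
have c_gt0 : (0 < c)%R by rewrite ceil_gt0 divr_gt0 ?ltr0n ?mulr_gt0.
have [n cn] : exists n, c = n.+1%:Z by case: c c_gt0 => -[|n] // _; exists n.
have nN : n%:R * (2 * C) < N%:R.
  rewrite -ltr_pdivlMr ?mulr_gt0 //.
  by have := ceilB1_lt (N%:R / (2 * C)); rewrite -/c cn -addn1 PoszD addrK.
(* The leading 2 cancels one halving, leaving [rate ^+ N] against the n-th power of 1/2, where [n]
   is less than N / (2C). *)
rewrite cn -exprnP exprS mulrACA divff ?pnatr_eq0 // mul1r ler_pM2l //.
have rateE : rate <= expR (- (2 / (5 * C))) by exact: expR_ge1Dx.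
(* Since 2N / (5C) >= 4n/5, it suffices that exp(4/5) >= 2, which follows from exp(1/5) >= 6/5 and
   (6/5)^4 > 2. *)
have half : expR (- (4 / 5)) <= (2^-1 : R).
  have e5 : 6 / 5 <= expR (5^-1 : R).
    by apply: le_trans (expR_ge1Dx _); lra.
  rewrite expRN lef_pV2 ?posrE ?expR_gt0 //.
  rewrite expRM_natl.
  apply: le_trans _ (lerXn2r 4 _ _ e5); rewrite ?nnegrE ?expR_ge0 //; lra.
apply: le_trans _ (lerXn2r n _ _ half); rewrite ?nnegrE ?expR_ge0 ?invr_ge0 //.
apply: le_trans (lerXn2r N _ _ rateE) _; rewrite ?nnegrE ?expR_ge0 //.
  exact: ltW rate_gt0.
rewrite -!expRM_natl ler_expR.
rewrite !mulrN lerN2 [leRHS]mulrA ler_pdivlMr ?mulr_gt0 //; lra.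
Qed.

End DecayRate.

(** * The recursion for the flip bound under coupling independence *)

Section InfluenceDecay.
Set Implicit Arguments. Unset Strict Implicit.
Context {R : realType} {V : finType} {q : nat}.
Variables (e : rel V) (AE : 'I_q -> 'I_q -> R) (AV : 'I_q -> R) (C : R).
Hypothesis e_sym : symmetric e.
Hypothesis AE_ge0 : forall a b, 0 <= AE a b.
Hypothesis AV_ge0 : forall a, 0 <= AV a.
Hypothesis CI : coupling_independence e AE AV C.

Local Notation mu := (mu_pin e AE AV).
Local Notation wd := (well_defined e AE AV).
Local Notation flip_bound := (flip_bound e AE AV).
Implicit Types (L : {set V}) (sigma tau : V -> 'I_q).

Lemma disagree_prob_flip L sigma tau v pi :
    differ_only_at L sigma tau v -> wd L sigma ->
    is_coupling (mu L sigma) (mu L tau) pi ->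
  disagree_prob pi v = 1.
Proof.
move=> [vL [stv _]] wds [pi0 [pi1 pi2]].
rewrite -(sum_mu_pin (wds : wd L sigma)).
under [RHS]eq_bigr do rewrite -pi1.
rewrite -big_config_pair; apply: eq_bigr => -[x y] _ /=.
have [->|pixy] := eqVneq (pi (x, y)) 0; first by rewrite mul0r.
have {}pixy : 0 < pi (x, y) by rewrite lt_neqAle eq_sym pixy pi0.
have /mu_pin_gt0/pin_weight_neq0[xs _ _] : 0 < mu L sigma x.
  by rewrite -pi1 (lt_le_trans pixy) // (bigD1 y) //= lerDl sumr_ge0.
have /mu_pin_gt0/pin_weight_neq0[yt _ _] : 0 < mu L tau y.
  by rewrite -pi2 (lt_le_trans pixy) // (bigD1 x) //= lerDl sumr_ge0.
by rewrite xs // yt // stv mulr1.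
Qed.

Lemma coupling_independence_ge1 L sigma tau v :
  differ_only_at L sigma tau v -> wd L sigma -> wd L tau -> 1 <= C.
Proof.
move=> diff wds wdt; have [pi [cpi le_pi]] := CI diff wds wdt.
apply: le_trans le_pi; rewrite exp_disagree_sum (bigD1 v) //=.
rewrite (disagree_prob_flip diff wds cpi) lerDl sumr_ge0 // => u _.
by apply: disagree_prob_ge0; case: cpi.
Qed.

Lemma flip_bound_total m : flip_bound m C.
Proof.
move=> L sigma tau v T diff wds wdt _; have [pi [cpi le_pi]] := CI diff wds wdt.
exists pi; split=> //; apply: le_trans le_pi; apply: exp_disagree_le.
by case: cpi.
Qed.

Hypothesis C1 : 1 <= C.
Local Notation rho := (rate C).

(* The budget [C] of a total coupling, of which [v] takes 1, cannot be exceeded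
   by the disagreements in the spheres around [v] and in [T] together. *)
Lemma some_sphere_cheap T N L sigma tau v pi (k := 1 - 3 / (5 * C)) :
    (0 < N)%N -> differ_only_at L sigma tau v -> wd L sigma -> beyond e N v T ->
    is_coupling (mu L sigma) (mu L tau) pi -> exp_disagree pi predT <= C ->
  (exists2 l : nat, (0 < l < N)%N &
     exp_disagree pi (in_sphere e l v) <= k * (2 / 5 * rho ^+ l)) \/
  exp_disagree pi T <= k * (C * rho ^+ N).
Proof.
case: N => // n _ diff wds vT cpi le_pi.
have [//|ltT] := leP (exp_disagree pi T); first by right.
have [l /andP[l0 le_l]|no] := pickP (fun l : 'I_n.+1 => (0 < l)%N &&
    (exp_disagree pi (in_sphere e l v) <= k * (2 / 5 * rho ^+ l))).
  by left; exists l; rewrite ?l0 ?ltn_ord.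
exfalso; have := exp_disagree_spheres (proj1 cpi) vT.
rewrite big_ord_recl /=.
have -> : exp_disagree pi (in_sphere e 0 v) = 1.
  rewrite exp_disagree_sum (big_pred1 v) ?(disagree_prob_flip diff wds cpi) // => u.
  by rewrite /in_sphere /= andb_idr // => _; apply/forallP => -[].
have : \sum_(i < n) k * (2 / 5 * rho ^+ i.+1)
    <= \sum_(i < n) exp_disagree pi (in_sphere e (lift ord0 i) v).
  apply: ler_sum => i _; have := no (lift ord0 i).
  by rewrite /= /bump leq0n add1n /= => /negbT; rewrite -ltNge => /ltW.
rewrite -mulr_sumr; have := congr1 ( *%R k) (sum_rate C1 n).
set s := \sum_(i < n) _; set t := \sum_(i < n) _.
have C0 : 0 < C := lt_le_trans ltr01 C1.
have k1 : k <= 1 by rewrite lerBlDr lerDl divr_ge0 // ltW // mulr_gt0.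
(* Were nothing cheap, the total would exceed 1 + k C [rho] = C + (2/5)(1 - k) >= C. The 3/5 in [k]
   is what remains of the unit spent at [v] after the defect 2/5 of the rate. *)
have : k * (C * rho) = C - 3 / 5 - 2 / 5 * k.
  rewrite (_ : C * rho = C - 2 / 5); last by have := rate_defect C1; lra.
  by rewrite /k; field; rewrite lt0r_neq0.
rewrite mulrDr => ->; lra.
Qed.

(* [flip_bound N] occurs on both sides because the flip of [v] with part of the
   sphere unpinned is again at distance [N] from [T]. Iterating the contraction
   removes this circularity without an optimal coupling, hence without
   compactness. *)
Lemma flip_bound_contract N B (k := 1 - 3 / (5 * C)) : (0 < N)%N ->
    (forall m, (m < N)%N -> flip_bound m (C * rho ^+ m)) ->
    flip_bound N B -> C * rho ^+ N <= B ->
  flip_bound N (k * B).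
Proof.
move=> N0 IH flipB le_B L sigma tau v T diff wds wdt vT.
have C0 : 0 < C := lt_le_trans ltr01 C1.
have k0 : 0 <= k.
  by rewrite /k subr_ge0 ler_pdivrMr ?mulr_gt0 // mul1r; move: C1; lra.
have [pi [cpi le_pi]] := CI diff wds wdt.
have rho0 m : 0 < rho ^+ m by rewrite exprn_gt0 // rate_gt0.
have [[l /[dup] lN /andP[l0 ltlN] le_l]|leT] :=
  some_sphere_cheap N0 diff wds vT cpi le_pi.
  have := flip_bound_via_sphere e_sym AE_ge0 AV_ge0 lN (IH (N - l)%N _)
    flipB _ _ diff wds wdt vT cpi.
  have phi0 : 0 <= C * rho ^+ (N - l) by rewrite mulr_ge0 // ltW.
  have B0 : 0 <= B by apply: le_trans le_B; rewrite mulr_ge0 // ltW.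
  rewrite ltn_subrL l0 N0 => /(_ isT phi0 B0).
  apply: transport_leW; apply: le_trans (ler_wpM2r _ le_l) _; first lra.
  rewrite -[leLHS]mulrA; apply: ler_wpM2l => //.
  have rhoN : rho ^+ N = rho ^+ l * rho ^+ (N - l) by rewrite -exprD subnKC // ltnW.
  have rhol : rho ^+ l <= 1 by rewrite exprn_ile1 ?rate_le1 // ltW ?rate_gt0.
  (* The two summands are at most (4/5) [B] and (1/5) [B], by C [rho]^N <= [B] and [rho]^l <= 1. *)
  by move: le_B; rewrite rhoN; nra.
by exists pi; split=> //; apply: le_trans leT _; rewrite ler_wpM2l.
Qed.

Lemma flip_bound_rate N : flip_bound N (C * rho ^+ N).
Proof.
elim/ltn_ind: N => -[|N] IH; first by rewrite mulr1; exact: flip_bound_total.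
set b := C * _.
have C0 : 0 < C := lt_le_trans ltr01 C1.
have b0 : 0 < b by rewrite mulr_gt0 ?exprn_gt0 ?rate_gt0.
(* While the current bound is at least [b], one contraction lowers it by at least [d]. *)
pose d := 3 / (5 * C) * b.
have d0 : 0 < d by apply: mulr_gt0 => //; rewrite divr_gt0 ?mulr_gt0.
(* The maximum keeps the bound above [b], as the contraction requires; by the Archimedean property
   it equals [b] after finitely many rounds. *)
have flip_n n : flip_bound N.+1 (Num.max b (C - n%:R * d)).
  elim: n => [|n IHn] L sigma tau v T diff wds wdt vT.
    apply: (transport_leW _ (flip_bound_total diff wds wdt vT)).
    by rewrite mul0r subr0 le_max lexx orbT.
  have := flip_bound_contract (ltn0Sn N) IH IHn _ diff wds wdt vT.
  rewrite le_max lexx => /(_ isT); apply: transport_leW.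
  have k0 : 0 < 3 / (5 * C) by rewrite divr_gt0 ?mulr_gt0.
  set B := Num.max b (C - n%:R * d); set B' := Num.max b _.
  have bB : b <= B by rewrite le_max lexx.
  have bB' : b <= B' by rewrite le_max lexx.
  have CB' : C - n.+1%:R * d <= B' by rewrite le_max lexx orbT.
  apply: (@le_trans _ _ (B - d)); first by rewrite mulrBl mul1r lerD2l lerN2 ler_pM2l.
  by rewrite lerBlDr ge_max; apply/andP; split; rewrite -natr1 in CB'; lra.
have := flip_n (Num.bound (C / d)); rewrite max_l // lerBlDr.
have := archi_boundP (ltW (divr_gt0 C0 d0)); rewrite ltr_pdivrMr // => /ltW ?.
by rewrite ler_wpDl // ltW.
Qed.

End InfluenceDecay.

Theorem theorem3p2 (R : realType) (V : finType) (q : nat) (e : rel V)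
    (AE : 'I_q -> 'I_q -> R) (AV : 'I_q -> R) (C : R) :
  symmetric e -> irreflexive e ->
  (forall a b, 0 <= AE a b) -> (forall a, 0 <= AV a) ->
  0 < C ->
  coupling_independence e AE AV C ->
  (forall (Rad : nat), (0 < Rad)%N ->
    forall (L : {set V}) (sigma tau : V -> 'I_q) (v : V),
      differ_only_at L sigma tau v ->
      well_defined e AE AV L sigma -> well_defined e AE AV L tau ->
      exists pi,
        is_coupling (mu_pin e AE AV L sigma) (mu_pin e AE AV L tau) pi /\
        exp_disagree pi (in_sphere e Rad v)
          <= 2 * C * (2^-1) ^ (Num.ceil (Rad%:R / (2 * C))))
  /\
  (forall (L : {set V}) (sigma tau : V -> 'I_q) (v : V) (l : nat),
      differ_only_at L sigma tau v ->
      well_defined e AE AV L sigma -> well_defined e AE AV L tau ->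
      (0 < l)%N ->
      \sum_(u | in_sphere e l v u) dTV_marg e AE AV L sigma tau u
        <= 2 * C * 2 ^ (- Num.ceil (l%:R / (2 * C)))).
Proof.
move=> e_sym _ AE_ge0 AV_ge0 _ CI.
have main Rad : (0 < Rad)%N -> forall L sigma tau v,
    differ_only_at L sigma tau v ->
    well_defined e AE AV L sigma -> well_defined e AE AV L tau ->
    transport_le (in_sphere e Rad v) (mu_pin e AE AV L sigma) (mu_pin e AE AV L tau)
      (2 * C * (2^-1) ^ (Num.ceil (Rad%:R / (2 * C)))).
  move=> Rad0 L sigma tau v diff wds wdt.
  (* Coupling independence may hold vacuously with C < 1; the given flip forces C >= 1, as [v]
     always disagrees. *)
  have C1 := coupling_independence_ge1 CI diff wds wdt.
  apply: transport_leW (rate_decay C1 Rad0) _.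
  apply: (flip_bound_rate e_sym AE_ge0 AV_ge0 CI C1 diff wds wdt).
  by move=> j u jR /andP[_ /forallP/(_ (Ordinal jR))].
split=> [|L sigma tau v l diff wds wdt l0]; first exact: main.
(* The same coupling bounds all marginal distances on the sphere at once, through the coupling
   inequality at each vertex. *)
rewrite -exprz_inv; have [pi [cpi le_pi]] := main l l0 L sigma tau v diff wds wdt.
apply: le_trans le_pi; rewrite exp_disagree_sum; apply: ler_sum => u _.
exact: marginal_dist_le.
Qed.
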